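(* Let $V_1,\ldots,V_r$ be finite-dimensional complex vector spaces, $W=V_1\oplus\cdots\oplus V_r$, and $B=A_1\oplus\cdots\oplus A_r$, where $A_j=\lambda_jI_j+N_j$ is a linear transformation on $V_j$ $(j=1,\ldots,r)$ for some pairwise distinct complex numbers $\lambda_1,\ldots,\lambda_r$ and pairwise similar nilpotent linear transformations $N_1,\ldots,N_r$ (with $N_j$ acting on $V_j$ and $I_j$ the identity on $V_j$). Let $V_0$ be a vector space isomorphic to the spaces $V_j$, let $N$ be a linear transformation on $V_0$ similar to the $N_j$, and let $S_j\colon V_0\to V_j$ be invertible linear transformations such that $N_j=S_jNS_j^{-1}$ $(j=1,\ldots,r)$. A linear transformation $T$ on $W$ is in $\mathrm{Col}(B)$ if and only if there exist a permutation $\pi$ of $\{1,\ldots,r\}$ and collineations $T_1,\ldots,T_r\in\mathrm{Col}(N)$ such that the operator matrix of $T$ with respect to the decomposition $W=V_1\oplus\cdots\oplus V_r$ is of the form $[T_{ij}]_{i,j=1}^{r}$, where $T_{\pi(k)k}=S_{\pi(k)}T_kS_k^{-1}$ for $k=1,\ldots,r$, and $T_{ij}=0$ if $(i,j)\neq(\pi(k),k)$ for every $k$.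
   Context: For a linear transformation $C$ on a finite-dimensional complex vector space $U$, $\mathrm{Lat}(C)$ is the lattice of all subspaces $M\subseteq U$ with $CM\subseteq M$, and $\mathrm{Col}(C)$ is the group of all invertible linear transformations $S$ on $U$ such that for every subspace $M$ of $U$ one has $M\in\mathrm{Lat}(C)\iff SM\in\mathrm{Lat}(C)$; elements of $\mathrm{Col}(C)$ are called collineations of $C$. The entry $T_{ij}\colon V_j\to V_i$ of the operator matrix is the compression of $T$ from the summand $V_j$ to the summand $V_i$. Transformations on two spaces are similar if they are conjugate by an invertible linear map between the spaces. *)

(* Defs.v *)
From HB Require Import structures.
From mathcomp Require Import all_boot all_order all_algebra all_fingroup.
From mathcomp Require Import complex reals.

Set Implicit Arguments.
Unset Strict Implicit.
Unset Printing Implicit Defensive.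

Import GRing.Theory.

Local Open Scope ring_scope.

(* External direct sum of a family of possibly different spaces; the library
   only has the constant case {ffun I -> vT}. *)
Definition dsum (K : fieldType) (r : nat) (V : 'I_r -> vectType K) : Type :=
  {dffun forall i : 'I_r, V i}.

Section DirectSumSpace.
Variables (K : fieldType) (r : nat) (V : 'I_r -> vectType K).
Implicit Types (u v w : dsum V) (a b : K).

HB.instance Definition _ := Choice.copy (dsum V) {dffun forall i : 'I_r, V i}.

Definition dsum_coord (i : 'I_r) w : V i := (w : {dffun forall i, V i}) i.

Definition dsum_of (f : forall i, V i) : dsum V := [ffun i => f i].

Lemma dsum_ofE f i : dsum_coord i (dsum_of f) = f i.
Proof. by rewrite /dsum_coord ffunE. Qed.

Lemma dsumP u v : (forall i, dsum_coord i u = dsum_coord i v) -> u = v.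
Proof. by move=> e; apply/ffunP => i; apply: e. Qed.

Definition dsum_zero : dsum V := dsum_of (fun=> 0).
Definition dsum_opp u : dsum V := dsum_of (fun i => - dsum_coord i u).
Definition dsum_add u v : dsum V :=
  dsum_of (fun i => dsum_coord i u + dsum_coord i v).
Definition dsum_scale a u : dsum V := dsum_of (fun i => a *: dsum_coord i u).

Fact dsum_addA : associative dsum_add.
Proof. by move=> u v w; apply: dsumP => i; rewrite !dsum_ofE addrA. Qed.
Fact dsum_addC : commutative dsum_add.
Proof. by move=> u v; apply: dsumP => i; rewrite !dsum_ofE addrC. Qed.
Fact dsum_add0 : left_id dsum_zero dsum_add.
Proof. by move=> u; apply: dsumP => i; rewrite !dsum_ofE add0r. Qed.
Fact dsum_addN : left_inverse dsum_zero dsum_opp dsum_add.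
Proof. by move=> u; apply: dsumP => i; rewrite !dsum_ofE addNr. Qed.

HB.instance Definition _ := GRing.isZmodule.Build (dsum V)
  dsum_addA dsum_addC dsum_add0 dsum_addN.

Fact dsum_scaleA a b u : dsum_scale a (dsum_scale b u) = dsum_scale (a * b) u.
Proof. by apply: dsumP => i; rewrite !dsum_ofE scalerA. Qed.
Fact dsum_scale1 : left_id 1 dsum_scale.
Proof. by move=> u; apply: dsumP => i; rewrite !dsum_ofE scale1r. Qed.
Fact dsum_scaleDr : right_distributive dsum_scale +%R.
Proof. by move=> a u v; apply: dsumP => i; rewrite !dsum_ofE scalerDr. Qed.
Fact dsum_scaleDl u : {morph dsum_scale^~ u : a b / a + b}.
Proof. by move=> a b; apply: dsumP => i; rewrite !dsum_ofE scalerDl. Qed.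

HB.instance Definition _ := GRing.Zmodule_isLmodule.Build K (dsum V)
  dsum_scaleA dsum_scale1 dsum_scaleDr dsum_scaleDl.

Fact dsum_coord_is_linear i : linear (dsum_coord i).
Proof. by move=> a u v; rewrite /= !dsum_ofE. Qed.

HB.instance Definition _ i := GRing.isLinear.Build K (dsum V) (V i) _
  (dsum_coord i) (dsum_coord_is_linear i).

Import VectorInternalTheory.

Fact dsum_vect_iso : Vector.axiom (\sum_(i < r) dim (V i)) (dsum V).
Proof.
exists (fun w => \mxrow_(i < r) v2r (dsum_coord i w)).
  move=> a u v; apply/mxrowP => i.
  have -> x : submxrow (a *: x + \mxrow_(j < r) v2r (dsum_coord j v)) i =
              a *: submxrow x i + v2r (dsum_coord i v).
    by rewrite submxrowD mxrowK; congr (_ + _); apply/matrixP => p q; rewrite !mxE.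
  by rewrite !mxrowK !linearP.
exists (fun x => dsum_of (fun i => r2v (submxrow x i))) => [w|x].
  by apply: dsumP => i; rewrite dsum_ofE mxrowK v2rK.
by apply/mxrowP => i; rewrite mxrowK dsum_ofE r2vK.
Qed.

HB.instance Definition _ := Lmodule_hasFinDim.Build K (dsum V) dsum_vect_iso.


Definition dsum_inj (j : 'I_r) (x : V j) : dsum V :=
  dsum_of (dfwith (fun i => 0 : V i) x).

Fact dsum_inj_is_linear j : linear (@dsum_inj j).
Proof.
move=> a x y; apply: dsumP => i; rewrite linearP /= !dsum_ofE.
have [->|ne_ij] := eqVneq i j; first by rewrite !dfwith_in.
by rewrite !dfwith_out 1?eq_sym // scaler0 addr0.
Qed.

HB.instance Definition _ j := GRing.isLinear.Build K (V j) (dsum V) _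
  (@dsum_inj j) (@dsum_inj_is_linear j).

Definition dsum_map (A : forall i, 'End(V i)) w : dsum V :=
  dsum_of (fun i => A i (dsum_coord i w)).

Fact dsum_map_is_linear A : linear (dsum_map A).
Proof.
move=> a u v; apply: dsumP => i.
by rewrite [RHS]linearP /= !dsum_ofE linearP.
Qed.

HB.instance Definition _ A := GRing.isLinear.Build K (dsum V) (dsum V) _
  (dsum_map A) (dsum_map_is_linear A).

Definition dsum_end (A : forall i, 'End(V i)) : 'End(dsum V) :=
  linfun (dsum_map A).

(* The entry T_ij : V_j -> V_i of the operator matrix of T. *)
Definition opmx_entry (T : 'End(dsum V)) (i j : 'I_r) : 'Hom(V j, V i) :=
  (linfun (dsum_coord i) \o T \o linfun (@dsum_inj j))%VF.

Lemma dsum_injE (j i : 'I_r) (x : V j) :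
  dsum_coord i (dsum_inj x) = dfwith (fun i => 0 : V i) x i.
Proof. by rewrite dsum_ofE. Qed.

Lemma dsum_endE A w i : dsum_coord i (dsum_end A w) = A i (dsum_coord i w).
Proof. by rewrite lfunE /= dsum_ofE. Qed.

Lemma opmx_entryE T i j x : opmx_entry T i j x = dsum_coord i (T (dsum_inj x)).
Proof. by rewrite !comp_lfunE !lfunE. Qed.

End DirectSumSpace.

Section Transformations.
Variables (K : fieldType) (U U' : vectType K).

Definition nilpotent_end (N : 'End(U)) : Prop :=
  exists k : nat, forall v : U, iter k N v = 0.

(* [S^-1%VF] is the two-sided inverse since S is bijective. *)
Definition similar_end (C : 'End(U)) (C' : 'End(U')) : Prop :=
  exists2 S : 'Hom(U, U'), bijective S & C' = (S \o C \o S^-1)%VF.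

Definition Lat (C : 'End(U)) : {pred {vspace U}} :=
  [pred M : {vspace U} | (C @: M <= M)%VS].

Definition Col (C : 'End(U)) (S : 'End(U)) : Prop :=
  bijective S /\
  forall M : {vspace U}, M \in Lat C <-> (S @: M)%VS \in Lat C.

End Transformations.

(* Main.v *)
(* A B-invariant subspace is the sum of its intersections with the root
   subspaces V_j.  Hence a line in Lat(B) lies in a single V_j.  If T is a
   collineation and T V_k met two of the V_j, then T V_k, being invariant, would
   contain eigenvectors z, z' of B in both; the preimages of z, z' are
   eigenvectors for the same eigenvalue, so their sum, and then z + z', spans an
   invariant line, which is impossible.  Equality of the dimensions of the V_k
   turns k |-> j into a permutation, and the blocks are collineations because
   Lat(N) embeds in Lat(B) through each summand. *)
Require Import Defs.
From mathcomp Require Import all_boot all_order all_algebra all_fingroup.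
From mathcomp Require Import complex reals.

Set Implicit Arguments.
Unset Strict Implicit.
Unset Printing Implicit Defensive.

Import GRing.Theory.

Local Open Scope ring_scope.
Local Open Scope complex_scope.

(** * Invariant subspaces and collineations of one transformation *)

Section Lattice.
Variables (K : fieldType) (U : vectType K).
Implicit Types (C N S : 'End(U)) (M : {vspace U}) (x : U) (c : K).

Lemma LatP C M : reflect (forall x, x \in M -> C x \in M) (M \in Lat C).
Proof.
apply: (iffP subvP) => h x; first by move=> Mx; apply: h; apply: memv_img.
by case/memv_imgP=> y My ->; apply: h.
Qed.

Lemma Lat_fullv C : fullv \in Lat C.
Proof. by apply/LatP => x _; apply: memvf. Qed.

Lemma Lat_vline C x : reflect (exists c, C x = c *: x) (<[x]>%VS \in Lat C).
Proof.
apply: (iffP (LatP _ _)) => [h|[c Cx] _ /vlineP[a ->]].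
  by apply/vlineP; apply: h; apply: memv_line.
by rewrite linearZ /= Cx scalerA mulrC -scalerA memvZ // memvZ // memv_line.
Qed.

(** Subspaces absorb scalar multiples of their vectors; thus summands with distinct eigenvalues
    share the single lattice [Lat N]. *)
Lemma Lat_scalarD c N M : (M \in Lat (c *: \1%VF + N)) = (M \in Lat N).
Proof.
apply/LatP/LatP => h x Mx; have := h x Mx; rewrite add_lfunE scale_lfunE id_lfunE.
  by rewrite rpredDl // memvZ.
by move=> Nx; rewrite rpredD // memvZ.
Qed.

Lemma bij_lker0 S : bijective S <-> lker S == 0%VS.
Proof.
split=> [/bij_inj/lker0P // | kerS].
by exists (S^-1)%VF; [apply: lker0_lfunK | apply: lker0_lfunVK].
Qed.

Lemma Col_lker0 C S : Col C S -> lker S == 0%VS.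
Proof. by case=> /bij_lker0. Qed.

Lemma Col_inv C S : Col C S -> Col C (S^-1)%VF.
Proof.
move=> ColS; have kerS := Col_lker0 ColS.
split; first by exists S; [apply: lker0_lfunVK | apply: lker0_lfunK].
move=> M; case: ColS => _ h; rewrite (h (S^-1 @: M)%VS) -limg_comp.
by rewrite lker0_compfV // lim1g.
Qed.

Lemma Col_id C : Col C \1%VF.
Proof. split=> [|M]; last by rewrite lim1g.
by exists id => x; rewrite id_lfunE. Qed.

End Lattice.

(** Injectivity pulls [f (C x)] in [f @: M] back to [C x] in [M]. This reads the lattice of a
    summand inside that of the sum. *)
Lemma Lat_img_inj (K : fieldType) (U W : vectType K) (f : 'Hom(U, W))
    (C : 'End(U)) (C' : 'End(W)) (M : {vspace U}) :
  injective f -> (forall x, C' (f x) = f (C x)) ->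
  ((f @: M)%VS \in Lat C') = (M \in Lat C).
Proof.
move=> f_inj fC; apply/LatP/LatP => [h x Mx|h _ /memv_imgP[x Mx ->]].
  have /memv_imgP[y My] : f (C x) \in (f @: M)%VS by rewrite -fC h // memv_img.
  by move/f_inj->.
by rewrite fC memv_img ?h.
Qed.

(** * Eigenvectors of a nilpotent transformation *)

Section Nilpotent.
Variables (K : fieldType) (U : vectType K) (N : 'End(U)).
Hypothesis N_nil : nilpotent_end N.

(** The iterates of [N] multiply [x] by powers of [c], which never vanish. *)
Lemma nilpotent_eigen (c : K) x : N x = c *: x -> c != 0 -> x = 0.
Proof.
case: N_nil => n Nn Nx c0; have iterN k : iter k N x = c ^+ k *: x.
  by elim: k => [|k /= ->]; rewrite ?scale1r // linearZ /= Nx scalerA exprSr.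
by apply/eqP; have /eqP := Nn x; rewrite iterN scaler_eq0 expf_eq0 (negPf c0) andbF.
Qed.

(** Take for [y] the last nonzero vector among the iterates of [N] at [x]. *)
Lemma nilpotent_Lat_ker (M : {vspace U}) x : M \in Lat N -> x \in M -> x != 0 ->
  exists y, [/\ y \in M, y != 0 & N y = 0].
Proof.
move=> /LatP N_M; case: N_nil => n /(_ x).
elim: n x => [x /= ->|n IHn x]; first by rewrite eqxx.
rewrite iterSr => Nn Mx x0; have [Nx0|Nx0] := eqVneq (N x) 0; first by exists x.
exact: IHn Nn (N_M _ Mx) Nx0.
Qed.

End Nilpotent.

(** * Products of shifted transformations *)

Section Shifts.
Variable K : fieldType.

(** The value at [C] of the monic polynomial with root list [s], repetitions counted. *)
Definition shifts (X : vectType K) (C : 'End(X)) (s : seq K) : 'End(X) :=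
  foldr (fun c f => ((C - c *: \1%VF) \o f)%VF) \1%VF s.

Lemma shifts_nil (X : vectType K) (C : 'End(X)) x : shifts C [::] x = x.
Proof. exact: id_lfunE. Qed.

Lemma shifts_cons (X : vectType K) (C : 'End(X)) c s x :
  shifts C (c :: s) x = C (shifts C s x) - c *: shifts C s x.
Proof. by rewrite /= comp_lfunE add_lfunE opp_lfunE scale_lfunE id_lfunE. Qed.

Lemma shifts_cat (X : vectType K) (C : 'End(X)) s t x :
  shifts C (s ++ t) x = shifts C s (shifts C t x).
Proof.
elim: s => [|c s IHs]; first by rewrite shifts_nil.
by rewrite cat_cons !shifts_cons IHs.
Qed.

Lemma shifts_Lat (X : vectType K) (C : 'End(X)) s (M : {vspace X}) x :
  M \in Lat C -> x \in M -> shifts C s x \in M.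
Proof.
move=> /LatP C_M Mx; elim: s => [|c s IHs]; first by rewrite shifts_nil.
by rewrite shifts_cons rpredB ?memvZ ?C_M.
Qed.

Lemma shifts_intertwine (X Y : vectType K) (f : 'Hom(X, Y)) (C : 'End(X))
    (D : 'End(Y)) s x :
  (forall x, D (f x) = f (C x)) -> shifts D s (f x) = f (shifts C s x).
Proof.
move=> fC; elim: s => [|c s IHs]; first by rewrite !shifts_nil.
by rewrite !shifts_cons IHs fC linearB /= [f (_ *: _)]linearZ.
Qed.

Variables (U : vectType K) (N : 'End(U)) (c : K).

(** Each factor is [(c - d) + N] with [d != c]; a nonzero kernel vector would be an eigenvector of
    [N] for the nonzero scalar [d - c]. *)
Lemma shifts_nilpotent_inj s : nilpotent_end N -> c \notin s ->
  injective (shifts (c *: \1%VF + N) s).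
Proof.
move=> N_nil s_c; apply/lker0P; rewrite -subv0; apply/subvP => x.
rewrite memv_ker memv0; elim: s s_c => [|d s IHs]; first by rewrite shifts_nil.
rewrite inE negb_or shifts_cons add_lfunE scale_lfunE id_lfunE.
case/andP=> cd s_c; rewrite addrAC -scalerBl addrC addr_eq0 -scaleNr => /eqP Ny.
apply: IHs s_c _; apply/eqP; apply: (nilpotent_eigen N_nil Ny).
by rewrite oppr_eq0 subr_eq0.
Qed.

Lemma shifts_nseq n x : shifts (c *: \1%VF + N) (nseq n c) x = iter n N x.
Proof.
elim: n => [|n IHn]; first by rewrite shifts_nil.
by rewrite shifts_cons IHn add_lfunE scale_lfunE id_lfunE addrAC subrr add0r.
Qed.

(** The [n] factors for [c] itself compose to the [n]-th iterate of [N], which is zero, and the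
    remaining factors on the left preserve zero. *)
Lemma shifts_kill (s : seq K) n x : (forall x, iter n N x = 0) -> c \in s ->
  shifts (c *: \1%VF + N) (flatten [seq nseq n d | d <- s]) x = 0.
Proof.
move=> Nn; elim: s => //= d s IHs; rewrite inE shifts_cat.
case/predU1P=> [<-|/IHs->]; last by rewrite linear0.
by rewrite shifts_nseq.
Qed.

End Shifts.

(** * Transformations with isomorphic root subspaces *)

Section Decomposition.
(* W is a direct sum of copies of U, with injections J i and projections Q i;
   identifying all summands with one space U avoids dependent families. *)
Variables (K : fieldType) (I : finType) (U W : vectType K).
Variables (N : 'End(U)) (B : 'End(W)) (lambda : I -> K).
Variables (J : I -> 'Hom(U, W)) (Q : I -> 'Hom(W, U)).
Hypotheses (QJ : forall i x, Q i (J i x) = x)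
  (QJ0 : forall i j x, i != j -> Q i (J j x) = 0)
  (JQ : forall w, \sum_i J i (Q i w) = w)
  (BJ : forall i x, B (J i x) = J i ((lambda i *: \1%VF + N)%VF x))
  (lambda_inj : injective lambda) (N_nil : nilpotent_end N).

Let J_inj i : injective (J i).
Proof. exact: can_inj (QJ i). Qed.

Lemma proj_sum_inj i (v : I -> U) : Q i (\sum_k J k (v k)) = v i.
Proof.
rewrite linear_sum (bigD1 i) //= QJ big1 ?addr0 // => k ki.
by rewrite QJ0 // eq_sym.
Qed.

Lemma proj_ext w w' : (forall i, Q i w = Q i w') -> w = w'.
Proof. by move=> e; rewrite -(JQ w) -(JQ w'); apply: eq_bigr => i _; rewrite e. Qed.

Lemma proj_intertwine i w : (lambda i *: \1%VF + N)%VF (Q i w) = Q i (B w).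
Proof.
rewrite -[in RHS](JQ w) [B _]linear_sum /=.
by under [in RHS]eq_bigr do rewrite BJ; rewrite proj_sum_inj.
Qed.

(* A product E of factors B - lambda_k, k != i, kills every other summand and is
   injective on the i-th one, hence bijective on its intersection with M. *)
Lemma Lat_proj_mem (M : {vspace W}) i w :
  M \in Lat B -> w \in M -> J i (Q i w) \in M.
Proof.
move=> B_M Mw; have [n Nn] := N_nil.
pose s := [seq lambda k | k <- enum I & k != i].
have s_i : lambda i \notin flatten [seq nseq n d | d <- s].
  apply/flattenP => -[_ /mapP[_ /mapP[k k_i ->] ->]]; rewrite mem_nseq.
  move: k_i; rewrite mem_filter eq_sym => /andP[/negPf ki _].
  by rewrite (inj_eq lambda_inj) ki andbF.
set t := flatten _ in s_i *; pose E := shifts (lambda i *: \1%VF + N)%VF t.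
have E_inj : injective E by apply: shifts_nilpotent_inj.
have kerE : lker E == 0%VS by apply/lker0P.
pose Mi := (J i @^-1: M)%VS.
have Mi_Lat : Mi \in Lat (lambda i *: \1%VF + N)%VF.
  by apply/LatP => x; rewrite -!memv_preim -BJ; apply/LatP.
have EMi : (E @: Mi = Mi)%VS.
  apply/eqP; rewrite eqEdim limg_dim_eq ?(eqP kerE) ?capv0 // leqnn andbT.
  by apply/subvP => _ /memv_imgP[x Mix ->]; apply: shifts_Lat.
have Bt : shifts B t w = J i (E (Q i w)).
  apply: proj_ext => k; rewrite -(shifts_intertwine _ _ (proj_intertwine k)).
  have [->|ki] := eqVneq k i; first by rewrite QJ.
  rewrite QJ0 // shifts_kill //; apply: map_f.
  by rewrite mem_filter ki mem_enum.
(* Surjectivity of [E] on [Mi] writes this vector as [E u] with [u] in [Mi]; injectivity then gives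
   [u = Q i w]. *)
have : E (Q i w) \in (E @: Mi)%VS by rewrite EMi -memv_preim -Bt shifts_Lat.
by case/memv_imgP=> u; rewrite -memv_preim => Mu /E_inj->.
Qed.

Lemma Lat_vline_inj i x : (<[J i x]>%VS \in Lat B) <-> N x = 0.
Proof.
rewrite -limg_line (Lat_img_inj _ (@J_inj i) (BJ i)) Lat_scalarD; split.
  case/Lat_vline=> c Nx; have [c0|c0] := eqVneq c 0.
    by rewrite Nx c0 scale0r.
  by rewrite (nilpotent_eigen N_nil Nx c0) linear0.
by move=> Nx; apply/Lat_vline; exists 0; rewrite Nx scale0r.
Qed.

(** The component [J i (Q i w)] stays on the line, so it is [a *: w]: coordinate [i] forces [a]
    nonzero, coordinate [j] gives [a *: Q j w = 0]. *)
Lemma Lat_vline_proj w i j : <[w]>%VS \in Lat B -> i != j ->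
  Q i w != 0 -> Q j w = 0.
Proof.
move=> w_Lat ij Qi; have /vlineP[a Ea] := Lat_proj_mem i w_Lat (memv_line w).
have := congr1 (Q i) Ea; have := congr1 (Q j) Ea.
rewrite QJ QJ0 1?eq_sym // !linearZ /= => /esym/eqP; rewrite scaler_eq0.
by case/predU1P=> [->|/eqP//]; rewrite scale0r => /eqP; rewrite (negPf Qi).
Qed.

Lemma Col_component (T : 'End(W)) (k : I) : Col B T -> fullv != 0%VS :> {vspace U} ->
  exists i, forall j x, j != i -> Q j (T (J k x)) = 0.
Proof.
move=> ColT U0; have kerT := Col_lker0 ColT; have T_inj := elimT lker0P kerT.
have line_T w : <[w]>%VS \in Lat B <-> <[T w]>%VS \in Lat B.
  by rewrite -limg_line; apply: ColT.2.
have [x0 [_ x0_neq0 Nx0]] : exists y : U, [/\ y \in fullv, y != 0 & N y = 0].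
  apply: (nilpotent_Lat_ker N_nil (Lat_fullv N) (memvf _) (x := vpick fullv)).
  by rewrite vpick0.
(* The index is read off from the single eigenvector [x0], before any [x] is considered. *)
have [i Qi] : exists i, Q i (T (J k x0)) != 0.
  apply/existsP; rewrite -negb_forall; apply: contra x0_neq0 => /forallP Q0.
  apply/eqP/(@J_inj k)/T_inj; rewrite !linear0; apply: proj_ext => i.
  by rewrite linear0; apply/eqP.
exists i => j x ji; apply/eqP/negPn/negP => Qj.
pose P := (T @: (J k @: fullv))%VS.
have P_Lat : P \in Lat B.
  by rewrite -ColT.2 (Lat_img_inj _ (@J_inj k) (BJ k)) Lat_fullv.
pose Pj := (J j @^-1: P)%VS.
have Pj_Lat : Pj \in Lat N.
  rewrite -(Lat_scalarD (lambda j)).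
  by apply/LatP => y; rewrite -!memv_preim -BJ; apply/LatP.
have Pjx : Q j (T (J k x)) \in Pj.
  by rewrite -memv_preim Lat_proj_mem // memv_img // memv_img // memvf.
have [y [Pjy y0 Ny]] := nilpotent_Lat_ker N_nil Pj_Lat Pjx Qj.
move: Pjy; rewrite -memv_preim => /memv_imgP[_ /memv_imgP[x' _ ->] Ey].
have Nx' : N x' = 0.
  by apply/(Lat_vline_inj k)/line_T; rewrite -Ey; apply/Lat_vline_inj.
have sum_Lat : <[T (J k (x0 + x')%R)]>%VS \in Lat B.
  by apply/(iffLR (line_T _))/Lat_vline_inj; rewrite linearD /= Nx0 Nx' addr0.
have x0_Lat : <[T (J k x0)]>%VS \in Lat B by apply/(iffLR (line_T _))/Lat_vline_inj.
have ij : i != j by rewrite eq_sym.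
(* The image of [x0 + x'] inherits a nonzero [i]-th coordinate from [x0], so its [j]-th coordinate,
   which is [y], would have to vanish. *)
have := Lat_vline_proj sum_Lat ij; rewrite !linearD /= -Ey QJ QJ0 // addr0.
by rewrite (Lat_vline_proj x0_Lat ij Qi) add0r => /(_ Qi)/eqP; apply/negP.
Qed.

Lemma Col_block_perm (T : 'End(W)) : Col B T ->
  exists (pi : {perm I}) (Tk : I -> 'End(U)),
    (forall k, Col N (Tk k)) /\ forall k x, T (J k x) = J (pi k) (Tk k x).
Proof.
move=> ColT; have [U0|U0] := eqVneq (fullv : {vspace U}) 0%VS.
  (* Over the zero space any permutation fits. *)
  have z (x : U) : x = 0 by apply/eqP; rewrite -memv0 -U0 memvf.
  exists 1%g, (fun=> \1%VF); split=> [k|k x]; first exact: Col_id.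
  by rewrite (z x) !linear0.
have T_inj := elimT lker0P (Col_lker0 ColT).
have [p p_spec] := fin_all_exists (fun k => Col_component k ColT U0).
pose Tk k := (Q (p k) \o T \o J k)%VF.
have TJ k x : T (J k x) = J (p k) (Tk k x).
  apply: proj_ext => j; rewrite /Tk !comp_lfunE.
  by have [->|jp] := eqVneq j (p k); rewrite ?QJ // QJ0 // p_spec.
have kerTk k : lker (Tk k) == 0%VS.
  apply/lker0P => x y e; apply: (@J_inj k); apply: T_inj.
  by rewrite !TJ e.
have p_inj : injective p.
  (* If [k] and [l] had the same target, surjectivity of [Tk k] would put [J l v] in the image of
     [J k]. *)
  move=> k l pkl; apply/eqP; apply: contraR U0 => kl.
  rewrite -vpick0; set v := vpick _.
  have : J k ((Tk k)^-1%VF (Tk l v)) = J l v.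
    by apply: T_inj; rewrite !TJ lker0_lfunVK // pkl.
  by move/(congr1 (Q l)); rewrite QJ QJ0 1?eq_sym // => <-.
exists (perm p_inj), Tk; split=> [k|k x]; last by rewrite permE TJ.
split=> [|M]; first exact/bij_lker0.
have imgTJ : (T @: (J k @: M))%VS = (J (p k) @: (Tk k @: M))%VS.
  rewrite -!limg_comp; apply: eq_in_limg => x _.
  by rewrite comp_lfunE [RHS]comp_lfunE TJ.
(* Invariance is carried along [J k], then [T], then back from [J (p k)]. *)
rewrite -(Lat_scalarD (lambda k)) -(Lat_img_inj _ (@J_inj k) (BJ k)).
rewrite -(Lat_scalarD (lambda (p k)) N (_ @: _)%VS).
by rewrite -(Lat_img_inj _ (@J_inj (p k)) (BJ (p k))) -imgTJ; apply: ColT.2.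
Qed.

(** An invariant [M] contains the components of its vectors, so invariance of the image can be
    tested one block at a time. *)
Lemma block_perm_Lat (T : 'End(W)) (pi : I -> I) (Tk : I -> 'End(U)) (M : {vspace W}) :
  (forall k, Col N (Tk k)) -> (forall k x, T (J k x) = J (pi k) (Tk k x)) ->
  M \in Lat B -> (T @: M)%VS \in Lat B.
Proof.
move=> ColTk TJ B_M; apply/LatP => _ /memv_imgP[w Mw ->].
rewrite -(JQ w) !linear_sum /=; apply: memv_suml => k _; rewrite TJ BJ.
pose Mk := (J k @^-1: M)%VS.
have Mk_Lat : Mk \in Lat N.
  rewrite -(Lat_scalarD (lambda k)).
  by apply/LatP => y; rewrite -!memv_preim -BJ; apply/LatP.
have /LatP TMk : (Tk k @: Mk)%VS \in Lat (lambda (pi k) *: \1%VF + N)%VF.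
  by rewrite Lat_scalarD -(ColTk k).2.
have /TMk/memv_imgP[u Mu ->] : Tk k (Q k w) \in (Tk k @: Mk)%VS.
  by rewrite memv_img // -memv_preim Lat_proj_mem.
by rewrite -TJ memv_img // memv_preim.
Qed.

Lemma block_perm_Col (T : 'End(W)) (pi : {perm I}) (Tk : I -> 'End(U)) :
  (forall k, Col N (Tk k)) -> (forall k x, T (J k x) = J (pi k) (Tk k x)) ->
  Col B T.
Proof.
move=> ColTk TJ.
have kerT : lker T == 0%VS.
  rewrite -subv0; apply/subvP => w; rewrite memv_ker memv0 => /eqP Tw.
  apply/eqP/proj_ext => k; rewrite linear0.
  apply: (elimT lker0P (Col_lker0 (ColTk k))); rewrite linear0.
  (* As [pi] is injective, coordinate [pi k] of [T w] comes from the [k]-th summand alone. *)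
  have := congr1 (Q (pi k)) Tw; rewrite linear0 -{1}(JQ w) linear_sum /=.
  under eq_bigr do rewrite TJ.
  rewrite linear_sum (bigD1 k) //= QJ big1 ?addr0 // => l lk.
  by rewrite QJ0 // (inj_eq perm_inj) eq_sym.
split=> [|M]; first exact/bij_lker0.
split=> [|TM]; first exact: block_perm_Lat ColTk TJ.
(* The inverse of [T] is again a block permutation, which gives the other implication. *)
pose Tk' k := (Tk ((pi^-1)%g k))^-1%VF.
have TJ' k x : (T^-1)%VF (J k x) = J ((pi^-1)%g k) (Tk' k x).
  apply: (elimT lker0P kerT); rewrite lker0_lfunVK // TJ permKV.
  by rewrite lker0_lfunVK // (Col_lker0 (ColTk _)).
have ColTk' k : Col N (Tk' k) by apply: Col_inv.
have := block_perm_Lat ColTk' TJ' TM.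
by rewrite -limg_comp lker0_compVf // lim1g.
Qed.

End Decomposition.

(** * Passage to the external direct sum of the [V j] *)

Theorem proposition7 (R : realType) (r : nat)
  (V : 'I_r -> vectType R[i])
  (lambda : 'I_r -> R[i]) (Nj : forall j : 'I_r, 'End(V j))
  (lambda_distinct : forall i j : 'I_r, i <> j -> lambda i <> lambda j)
  (Nj_nilpotent : forall j : 'I_r, nilpotent_end (Nj j))
  (Nj_similar : forall i j : 'I_r, similar_end (Nj i) (Nj j))
  (A : forall j : 'I_r, 'End(V j))
  (A_def : forall j : 'I_r, A j = lambda j *: \1%VF + Nj j)
  (V0 : vectType R[i]) (N : 'End(V0))
  (N_similar : forall j : 'I_r, similar_end N (Nj j))
  (S : forall j : 'I_r, 'Hom(V0, V j))
  (S_invertible : forall j : 'I_r, bijective (S j))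
  (S_conj : forall j : 'I_r, Nj j = (S j \o N \o (S j)^-1)%VF)
  (T : 'End(dsum V)) :
  Col (dsum_end A) T <->
  exists (pi : 'S_r) (Tk : 'I_r -> 'End(V0)),
    [/\ forall k : 'I_r, Col N (Tk k),
        forall k : 'I_r,
          opmx_entry T (pi k) k = (S (pi k) \o Tk k \o (S k)^-1)%VF
      & forall i j : 'I_r,
          (forall k : 'I_r, (i, j) <> (pi k, k)) -> opmx_entry T i j = 0].
Proof.
(* Each [S k] identifies [V k] with [V0] and turns [Nj k] into the same [N]. *)
pose J k : 'Hom(V0, dsum V) := (linfun (@dsum_inj _ _ V k) \o S k)%VF.
pose Q k : 'Hom(dsum V, V0) := ((S k)^-1 \o linfun (@dsum_coord _ _ V k))%VF.
have kerS k : lker (S k) == 0%VS by apply/lker0P/bij_inj.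
have SK k : cancel (S k) (S k)^-1%VF by apply: lker0_lfunK.
have SVK k : cancel (S k)^-1%VF (S k).
  case: (S_invertible k) => g gK gVK x.
  by rewrite -{1}(gVK x) SK gVK.
have JE k x : J k x = dsum_inj (S k x) by rewrite comp_lfunE lfunE.
have QE k w : Q k w = (S k)^-1%VF (dsum_coord k w) by rewrite comp_lfunE lfunE.
have coord_inj k (x : V k) : dsum_coord k (dsum_inj x) = x.
  by rewrite dsum_injE dfwith_in.
have coord_inj0 i k (x : V k) : i != k -> dsum_coord i (dsum_inj x) = 0.
  by move=> ik; rewrite dsum_injE dfwith_out // eq_sym.
have QJ k x : Q k (J k x) = x by rewrite QE JE coord_inj SK.
have QJ0 i k x : i != k -> Q i (J k x) = 0.
  by move=> ik; rewrite QE JE coord_inj0 // linear0.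
have JQ w : \sum_k J k (Q k w) = w.
  apply: dsumP => i; rewrite linear_sum (bigD1 i) //= big1 ?addr0.
    by rewrite JE QE SVK coord_inj.
  by move=> k ki; rewrite JE coord_inj0 // eq_sym.
have BJ k x : dsum_end A (J k x) = J k ((lambda k *: \1%VF + N)%VF x).
  apply: dsumP => i; rewrite dsum_endE !JE.
  have [->|ik] := eqVneq i k; last by rewrite !coord_inj0 // linear0.
  rewrite !coord_inj A_def !add_lfunE !scale_lfunE !id_lfunE linearD linearZ /=.
  by rewrite S_conj !comp_lfunE SK.
have lambda_inj : injective lambda.
  by move=> i j e; apply/eqP/negPn/negP => /eqP/lambda_distinct.
(* Nilpotency of [N] is inherited from some [Nj k], so it takes an index as argument. *)
have N_nil (k : 'I_r) : nilpotent_end N.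
  have [n Nn] := Nj_nilpotent k; exists n => v; apply: (can_inj (SK k)).
  rewrite linear0 -(Nn (S k v)); elim: n {Nn} => //= n <-.
  by rewrite S_conj !comp_lfunE SK.
have entryE i k x : opmx_entry T i k (S k x) = dsum_coord i (T (J k x)).
  by rewrite opmx_entryE JE.
(* For [r = 0] the sum is the zero space and both sides hold. *)
have [k0|I0] := pickP 'I_r; last first.
  have dsum0 (w w' : dsum V) : w = w' by apply: dsumP => k; have := I0 k.
  split=> _; first by exists 1%g, (fun=> 0); split=> [k|k|k l _]; have := I0 k.
  split=> [|M]; first by exists T => w; apply: dsum0.
  by split=> _; apply/LatP => w Mw; rewrite (dsum0 (_ w) w).
(* The two matrix conditions say exactly that [T] maps summand [k] to summand [pi k] through
   [Tk k]. *)
have T_blockP (pi : 'S_r) (Tk : 'I_r -> 'End(V0)) :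
    (forall k x, T (J k x) = J (pi k) (Tk k x)) <->
    (forall k, opmx_entry T (pi k) k = (S (pi k) \o Tk k \o (S k)^-1)%VF) /\
    (forall i j, (forall k, (i, j) <> (pi k, k)) -> opmx_entry T i j = 0).
  split=> [TJ|[Tdiag Toff] k x].
    split=> [k|i j ij]; apply/lfunP => x; rewrite -(SVK _ x) entryE TJ JE.
      by rewrite coord_inj !comp_lfunE SK.
    rewrite coord_inj0 ?zero_lfunE //; apply/eqP => ei.
    by apply: (ij j); rewrite ei.
  apply: dsumP => i; rewrite -entryE; have [->|ik] := eqVneq i (pi k).
    by rewrite Tdiag JE coord_inj !comp_lfunE SK.
  rewrite Toff ?zero_lfunE ?JE ?coord_inj0 // => l [ei el].
  by rewrite ei el eqxx in ik.
split=> [ColT|[pi [Tk [ColTk Tdiag Toff]]]].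
  have [pi [Tk [ColTk /T_blockP[Tdiag Toff]]]] :=
    Col_block_perm QJ QJ0 JQ BJ lambda_inj (N_nil k0) ColT.
  by exists pi, Tk; split.
apply: (block_perm_Col QJ QJ0 JQ BJ lambda_inj (N_nil k0) ColTk).
by apply/T_blockP.
Qed.
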